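(* Let $d\ge1$ be an integer. Let $\mathcal{H}_d$ be the family of all graphs $X_{h,q}$ and $X_{\widetilde h,q}$, where $q$ ranges over odd prime powers, $h(x,y)=f(g(x),g(y))$ and $\widetilde h(x,y)=g(x)g(y)f(g(x),g(y))$, with $f\in\mathbb{F}_q[x,y]$ an admissible polynomial whose degree in $x$ and whose degree in $y$ are both $1$, and $g\in\mathbb{F}_q[x]$ a polynomial of degree $d$. Then $\mathcal{H}_d$ is a family of quasi-random graphs with property $QR(1/2)$: there is $c>0$ such that for every graph in $\mathcal{H}_d$ (with vertex set $\mathbb{F}_q$) and all $S,T\subset\mathbb{F}_q$, $\left|e(S,T)-\frac{|S||T|}{2}\right|\le c\,q^{1/2}\sqrt{|S||T|}$.
   Context: $q$ is an odd prime power; an element of $\mathbb{F}_q$ is a square if it equals $z^2$ for some $z\in\mathbb{F}_q$ (so $0$ is a square). For $f\in\mathbb{F}_q[x,y]$, $X_{f,q}$ is the simple graph with vertex set $\mathbb{F}_q$ in which distinct $a,b$ are adjacent iff $f(a,b)$ is a square. Every $f$ can be written $f=F(x)G(y)H(x,y)$ with $H$ primitive in both $x$ and $y$ (no nonconstant factor lying in $\mathbb{F}_q[x]$ or $\mathbb{F}_q[y]$); $H$ is the primitive kernel. $f$ is admissible if (i) for all $u,v\in\mathbb{F}_q$, $f(u,v)$ is a square iff $f(v,u)$ is a square, and (ii) $H$ is not a constant multiple of the square of a polynomial. $e(S,T)$ is the number of pairs $(s,t)\in S\times T$ with $s,t$ adjacent. A family of graphs with unbounded numbers of vertices has property $QR(\theta)$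 if there is $c>0$ with $|e(S,T)-|S||T|/2|\le c n^\theta\sqrt{|S||T|}$ for all graphs in it ($n$ = number of vertices) and all vertex subsets $S,T$. *)

(* Defs.v *)
From HB Require Import structures.
From mathcomp Require Import all_boot all_order all_algebra.
From mathcomp Require Import polyXY.
From mathcomp Require Import reals exp.

Set Implicit Arguments.
Unset Strict Implicit.
Unset Printing Implicit Defensive.

Import GRing.Theory Num.Theory.
Local Open Scope ring_scope.

(* The field F_q, q an odd prime power, is an arbitrary [F : finFieldType] with
   [odd #|F|].  Bivariate polynomials follow polyXY: in [{poly {poly F}}] the
   outer variable 'X is x and the inner one 'Y is y, so that
   [g^:P] is g(x), [g%:P] is g(y), [f.[a, b]] is f(a, b),
   [size f] is 1 + deg_x f and [sizeY f] is 1 + deg_y f (for f != 0). *)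

Section Polynomials.

Variable F : finFieldType.
Implicit Types (a u v : F) (f H K : {poly {poly F}}) (g p A B : {poly F}).

Definition is_square a : Prop := exists z, a = z ^+ 2.

Definition is_squareb a : bool := [exists z, a == z ^+ 2].

Lemma is_squareP a : reflect (is_square a) (is_squareb a).
Proof. by apply: (iffP existsP) => -[z zP]; exists z; apply/eqP. Qed.

Definition primitive_x H : Prop :=
  forall p K, H = p^:P * K -> (size p <= 1)%N.

Definition primitive_y H : Prop :=
  forall p K, H = p%:P * K -> (size p <= 1)%N.

Definition primitive_kernel f H : Prop :=
  [/\ primitive_x H, primitive_y H & exists A B, f = A^:P * B%:P * H].

Definition sq_symmetric f : Prop :=
  forall u v, is_square f.[u, v] <-> is_square f.[v, u].

(* The primitive kernel of f != 0 is unique up to a nonzero constant, so the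
   choice of H is immaterial; f = 0 has kernel 1 and is not admissible. *)
Definition admissible f : Prop :=
  sq_symmetric f /\
  forall H, primitive_kernel f H ->
    ~ exists c : F, exists K, H = c%:P%:P * K ^+ 2.

(* f(g(x), g(y)): substitute g(y) for y in the coefficients, then g(x) for x *)
Definition poly_h f g : {poly {poly F}} :=
  map_poly (comp_poly g) f \Po g^:P.

Definition poly_htilde f g : {poly {poly F}} :=
  g^:P * g%:P * poly_h f g.

Lemma poly_hE f g u v : (poly_h f g).[u, v] = f.[g.[u], g.[v]].
Proof.
rewrite /poly_h horner_comp horner_map -/(g.[u]%:P).
rewrite -[X in (map_poly _ f).[X]](comp_polyC _ g).
by rewrite horner_map /= horner_comp.
Qed.

Lemma poly_htildeE f g u v :
  (poly_htilde f g).[u, v] = g.[u] * g.[v] * f.[g.[u], g.[v]].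
Proof.
by rewrite /poly_htilde !hornerM poly_hE hornerC horner_map /= hornerC.
Qed.

End Polynomials.

(* Adjacency is not bundled with a symmetry proof: for f = y - x - 1 over F_3,
   which is admissible, and g = x, the relation defining the graph of
   g(x) g(y) f(g(x), g(y)) is not symmetric (it contains (1, 2) but not (2, 1)).
   In general the relation of [Xgraph f] is symmetric iff f is [sq_symmetric]. *)
Record graph := Graph { vertex :> finType; adj : rel vertex }.

Definition simple_graph (G : graph) : Prop :=
  symmetric (@adj G) /\ irreflexive (@adj G).

Definition Xgraph (F : finFieldType) (f : {poly {poly F}}) : graph :=
  @Graph F (fun a b => (a != b) && is_squareb f.[a, b]).

Lemma Xgraph_simple (F : finFieldType) (f : {poly {poly F}}) :
  simple_graph (Xgraph f) <-> sq_symmetric f.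
Proof.
split=> [[fS _] u v | fS].
  have [-> //|uv] := eqVneq u v.
  have := fS u v; rewrite /= uv eq_sym uv /= => e.
  by split=> /is_squareP sq; apply/is_squareP; [rewrite -e | rewrite e].
split=> [u v | u] /=; last by rewrite eqxx.
rewrite eq_sym; congr (_ && _).
by apply/is_squareP/is_squareP; apply fS.
Qed.

Lemma Xgraph_h_simple (F : finFieldType) (f : {poly {poly F}}) (g : {poly F}) :
  admissible f -> simple_graph (Xgraph (poly_h f g)).
Proof. by case=> fS _; apply/Xgraph_simple => u v; rewrite !poly_hE. Qed.

Definition edges (G : graph) (S T : {set G}) : nat :=
  #|[set p : G * G | [&& p.1 \in S, p.2 \in T & adj p.1 p.2]]|.

Definition graph_family := graph -> Prop.

Definition unbounded (Fam : graph_family) : Prop :=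
  forall N : nat, exists2 G, Fam G & (N < #|G|)%N.

Definition QR (R : realType) (theta : R) (Fam : graph_family) : Prop :=
  unbounded Fam /\
  exists2 c : R, 0 < c & forall G, Fam G -> forall S T : {set G},
    `| (edges S T)%:R - #|S|%:R * #|T|%:R / 2 |
      <= c * (#|G|%:R `^ theta) * Num.sqrt (#|S|%:R * #|T|%:R).

Definition bidegree11 (F : finFieldType) (f : {poly {poly F}}) : Prop :=
  size f = 2%N /\ sizeY f = 2%N.

Variant family_H (d : nat) : graph_family :=
| family_h (F : finFieldType) (f : {poly {poly F}}) (g : {poly F}) of
    odd #|F| & admissible f & bidegree11 f & size g = d.+1 :
    family_H d (Xgraph (poly_h f g))
| family_htilde (F : finFieldType) (f : {poly {poly F}}) (g : {poly F}) of
    odd #|F| & admissible f & bidegree11 f & size g = d.+1 :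
    family_H d (Xgraph (poly_htilde f g)).

(* Main.v *)
(* Write f(u, v) = (a u + c) v + (b u + e).  If a e = b c then f splits as A(x) B(y), so its
   kernel is constant; hence admissibility gives a e - b c <> 0.  For the quadratic character
   chi, two distinct rows u, u' of the matrix chi(f(u, v)) have inner product
   - chi(a u + c) chi(a u' + c), so the Gram matrix is at most (q + 1) Id minus a rank-one
   square, and the matrix has norm at most sqrt(q + 1).  For both h and htilde the entry at
   (x, y) is chi(k(x)) chi(k(y)) chi(f(g(x), g(y))) with k = 1 or k = g; pushing the signed
   indicators of S and T forward along g, whose fibers have at most d points, multiplies the
   bound by at most d.  The zeros of the polynomial and the diagonal contribute error terms of
   the same order. *)
Require Import Defs.
From mathcomp Require Import all_boot all_order all_algebra.
From mathcomp Require Import cyclic finfield polyXY ring lra zify.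
From mathcomp Require Import reals exp.

Set Implicit Arguments.
Unset Strict Implicit.
Unset Printing Implicit Defensive.

Import Order.TTheory GRing.Theory Num.Theory.
Local Open Scope ring_scope.

(** * Quadratic character sums over a finite field of odd order *)

Section QuadraticCharacter.

Variables (R : realDomainType) (F : finFieldType).
Hypothesis oddF : odd #|F|.
Implicit Types u v w : F.

Definition quad_char w : R :=
  if w == 0 then 0 else if is_squareb w then 1 else -1.

Local Notation chi := quad_char.

Lemma quad_char0 : chi 0 = 0.
Proof. by rewrite /quad_char eqxx. Qed.

Lemma finField_prim_root : {z : F | #|F|.-1.-primitive_root z}.
Proof.
have F1 := finNzRing_gt1 F.
pose rs := enum (predC1 (0 : F)).
have rs_size : size rs = #|F|.-1 by rewrite -cardE cardC1.
have : has #|F|.-1.-primitive_root rs.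
  apply: has_prim_root; rewrite ?enum_uniq ?rs_size //; first by case: #|F| F1 => [|[]].
  apply/allP => x; rewrite mem_enum inE => x0.
  rewrite unity_rootE; apply/eqP/(mulfI x0).
  by rewrite -exprS prednK ?expf_card ?mulr1 // ltnW.
by move/hasP/sig2W => [z _ zP]; exists z.
Qed.

Let z : F := sval finField_prim_root.

Let z_prim : #|F|.-1.-primitive_root z := svalP finField_prim_root.

Let z_neq0 : z != 0.
Proof. by rewrite (prim_root_eq0 z_prim); case: #|F| (finNzRing_gt1 F) => [|[]]. Qed.

Let prim_root_powP w : w != 0 -> {i | w = z ^+ i}.
Proof.
move=> w0; have w1 : w ^+ #|F|.-1 = 1.
  apply/(mulfI w0).
  by rewrite -exprS prednK ?expf_card ?mulr1 // ltnW // finNzRing_gt1.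
by have [i ->] := prim_rootP z_prim w1; exists i.
Qed.

(** Exponents of [z] matter only modulo [q - 1], which is even because [q] is odd, so their parity
    is well defined. *)
Let is_squareb_prim_root i : is_squareb (z ^+ i) = ~~ odd i.
Proof.
apply/existsP/idP => [[w /eqP zw]|ei]; last first.
  by exists (z ^+ i./2); rewrite -exprM muln2 halfK (negbTE ei) subn0.
have w0 : w != 0.
  apply/eqP => w0; move/eqP: zw.
  by rewrite w0 expr0n expf_eq0 (negbTE z_neq0) andbF.
have [j wj] := prim_root_powP w0.
have /eqP := zw; rewrite wj -exprM (eq_prim_root_expr z_prim) => /eqP e.
have ev : ~~ odd #|F|.-1.
  by move: oddF (finNzRing_gt1 F); case: #|F| => [|n] //=.
have parity k : odd (k %% #|F|.-1) = odd k.
  by rewrite [in RHS](divn_eq k #|F|.-1) oddD oddM (negbTE ev) andbF.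
by rewrite -parity e parity muln2 odd_double.
Qed.

Let quad_char_prim_root i : chi (z ^+ i) = (-1) ^+ i.
Proof.
rewrite /quad_char expf_eq0 (negbTE z_neq0) andbF is_squareb_prim_root.
by rewrite -signr_odd; case: odd; rewrite ?expr1.
Qed.

Lemma quad_charM u v : chi (u * v) = chi u * chi v.
Proof.
have [->|u0] := eqVneq u 0; first by rewrite mul0r quad_char0 mul0r.
have [->|v0] := eqVneq v 0; first by rewrite mulr0 quad_char0 mulr0.
have [i ->] := prim_root_powP u0; have [j ->] := prim_root_powP v0.
by rewrite -exprD !quad_char_prim_root exprD.
Qed.

(** Multiplication by the generator [z] permutes [F] and flips the sign of [chi], so the sum equals
    its own opposite. *)
Lemma sum_quad_char : \sum_w chi w = 0.
Proof.
have zI : injective ( *%R z) by exact: mulfI.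
have : \sum_w chi w = - \sum_w chi w.
  rewrite {1}(reindex_inj zI) -sumrN; apply: eq_bigr => w _ /=.
  by rewrite quad_charM -(expr1 z) quad_char_prim_root expr1 mulN1r.
lra.
Qed.

Lemma quad_char1 : chi 1 = 1.
Proof. by rewrite -(expr0 z) quad_char_prim_root. Qed.

Lemma quad_char_sqr w : chi w ^+ 2 = (w != 0)%:R.
Proof.
rewrite /quad_char; case: eqP => _; rewrite ?expr0n //.
by case: ifP; rewrite ?sqrrN expr1n.
Qed.

Lemma quad_char_norm_le1 w : `|chi w| <= 1.
Proof.
by rewrite /quad_char; do 2?case: ifP; rewrite ?normr0 ?normrN ?normr1 ?ler01.
Qed.

(** Turns edge counts into character sums; the last term appears because 0 counts as a square while
    [chi 0 = 0]. *)
Lemma is_squareb_quad_char w :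
  2 * (is_squareb w)%:R = 1 + chi w + (w == 0)%:R :> R.
Proof.
rewrite /quad_char; have [->|w0] := eqVneq w 0.
  have -> : is_squareb (0 : F) by apply/is_squareP; exists 0; rewrite expr0n.
  by rewrite addr0 mulr1.
by case: is_squareb; rewrite /= ?mulr1 ?mulr0 ?addr0 ?subrr.
Qed.

Lemma sum_quad_char_affine a b : a != 0 -> \sum_v chi (a * v + b) = 0.
Proof.
move=> a0; have fI : injective (fun v => a * v + b).
  by move=> u v /addIr /(mulfI a0).
by rewrite -[RHS]sum_quad_char [RHS](reindex_inj fI).
Qed.

(* For w != 0, chi (w * (w + e)) = chi (1 + e / w). *)
Lemma sum_quad_char_shift e : e != 0 -> \sum_w chi w * chi (w + e) = -1.
Proof.
move=> e0; rewrite (bigD1 0) //= quad_char0 mul0r add0r.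
(* With the convention [0^-1 = 0] this map permutes all of [F] and sends 0 to 1. Removing the term
   [chi 1 = 1] from the vanishing full sum leaves -1. *)
have fI : injective (fun w => 1 + e * w^-1).
  by move=> u v /addrI /(mulfI e0) /invr_inj.
have := sum_quad_char; rewrite (reindex_inj fI) (bigD1 0) //=.
rewrite invr0 mulr0 addr0 quad_char1 => /eqP.
rewrite addrC addr_eq0 => /eqP <-; apply: eq_bigr => w w0.
rewrite -quad_charM (_ : w * (w + e) = w * w * (1 + e * w^-1)); last by field.
by rewrite !quad_charM -expr2 quad_char_sqr w0 mul1r.
Qed.

(** If [a] or [a'] is 0, one factor is constant and both sides vanish. Otherwise factor out
    [chi a * chi a'] and translate by [b / a]; the hypothesis makes the remaining shift
    [b' / a' - b / a] nonzero. *)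
Lemma sum_quad_char_affine2 a b a' b' : a * b' != a' * b ->
  \sum_v chi (a * v + b) * chi (a' * v + b') = - (chi a * chi a').
Proof.
have [->|a0] := eqVneq a 0.
  rewrite mul0r eq_sym mulf_eq0 negb_or => /andP[a'0 _].
  under eq_bigr do rewrite mul0r add0r.
  by rewrite -mulr_sumr sum_quad_char_affine // quad_char0 mulr0 mul0r oppr0.
have [->|a'0] := eqVneq a' 0.
  rewrite mul0r mulf_eq0 negb_or => /andP[_ b'0].
  under eq_bigr do rewrite mul0r add0r.
  by rewrite -mulr_suml sum_quad_char_affine // quad_char0 mulr0 mul0r oppr0.
move=> D.
have e0 : b' / a' - b / a != 0.
  apply: contraNneq D => /eqP; rewrite subr_eq0 => /eqP e.
  by rewrite -[b'](mulfVK a'0) e; apply/eqP; field.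
rewrite -mulrN1 -(sum_quad_char_shift e0) mulr_sumr.
have fI : injective (fun v => v + b / a) by apply: addIr.
rewrite [RHS](reindex_inj fI) /=; apply: eq_bigr => v _.
rewrite -!quad_charM; congr chi; field; exact/andP.
Qed.

End QuadraticCharacter.

(** * Cauchy-Schwarz and the norm of the matrix chi(f(u, v)) *)

Lemma sum_mul_sqr_le (R : realDomainType) (I : finType) (a b : I -> R) :
  (\sum_i a i * b i) ^+ 2 <= (\sum_i a i ^+ 2) * (\sum_i b i ^+ 2).
Proof.
have : 0 <= \sum_i \sum_j (a i * b j - a j * b i) ^+ 2.
  by do 2!apply: sumr_ge0 => ? _; exact: sqr_ge0.
(* Lagrange's identity: the defect in Cauchy-Schwarz is half a sum of squares. *)
have -> : \sum_i \sum_j (a i * b j - a j * b i) ^+ 2 =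
    2 * ((\sum_i a i ^+ 2) * (\sum_i b i ^+ 2)) - 2 * (\sum_i a i * b i) ^+ 2.
  rewrite expr2 mulr2n mulrDl !mul1r [X in _ + X - _]mulrC !big_distrlr /=.
  rewrite mulr_sumr -big_split /= -sumrB; apply: eq_bigr => i _.
  rewrite mulr_sumr -big_split /= -sumrB; apply: eq_bigr => j _.
  ring.
lra.
Qed.

Section BilinearSum.

Variables (R : realDomainType) (F : finFieldType).
Hypothesis oddF : odd #|F|.
Variables a b c e : F.
Hypothesis det_neq0 : a * e - b * c != 0.

Local Notation chi := (quad_char R).
Local Notation coef u := (a * u + c).
Local Notation f u v := (coef u * v + (b * u + e)).

Lemma quad_char_matrix_le (s : F -> R) :
  \sum_v (\sum_u s u * chi (f u v)) ^+ 2 <=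
  #|F|.+1%:R * \sum_u s u ^+ 2.
Proof.
pose G u u' := \sum_v chi (f u v) * chi (f u' v).
have -> : \sum_v (\sum_u s u * chi (f u v)) ^+ 2 =
    \sum_u \sum_u' s u * s u' * G u u'.
  under eq_bigr do rewrite expr2 big_distrlr /=.
  rewrite exchange_big; apply: eq_bigr => u _ /=.
  rewrite exchange_big; apply: eq_bigr => u' _ /=.
  by rewrite mulr_sumr; apply: eq_bigr => v _; ring.
(* The off-diagonal value, a rank-one matrix, is extended to the diagonal, and a diagonal matrix
   corrects it there. *)
have GE u u' : G u u' =
    - (chi (coef u) * chi (coef u')) + (G u u + chi (coef u) ^+ 2) *+ (u == u').
  have [<-|neq] := eqVneq u u'; first by rewrite mulr1n; ring.
  rewrite mulr0n addr0 /G sum_quad_char_affine2 //; rewrite -subr_eq0.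
  have -> : coef u * (b * u' + e) - coef u' * (b * u + e) =
      (a * e - b * c) * (u - u') by ring.
  by rewrite mulf_neq0 // subr_eq0.
have -> : \sum_u \sum_u' s u * s u' * G u u' =
    - (\sum_u s u * chi (coef u)) ^+ 2 +
    \sum_u s u ^+ 2 * (G u u + chi (coef u) ^+ 2).
  rewrite expr2 big_distrlr -sumrN -big_split /=; apply: eq_bigr => u _.
  have -> : s u ^+ 2 * (G u u + chi (coef u) ^+ 2) =
      \sum_u' s u * s u' * (G u u + chi (coef u) ^+ 2) *+ (u == u').
    rewrite (bigD1 u) //= eqxx big1 ?addr0 // => u' neq.
    by rewrite eq_sym (negbTE neq).
  rewrite -sumrN -big_split; apply: eq_bigr => u' _ /=.
  rewrite GE; case: eqP => _; rewrite ?mulr1n ?mulr0n; ring.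
(* The rank-one part contributes minus a square and is dropped. In each remaining entry, [G u u] is
   at most [q] and the added square at most 1. *)
apply: (@le_trans _ _ (\sum_u s u ^+ 2 * (G u u + chi (coef u) ^+ 2))).
  by rewrite gerDr oppr_le0 sqr_ge0.
rewrite mulr_sumr; apply: ler_sum => u _; rewrite mulrC ler_wpM2r ?sqr_ge0 //.
rewrite quad_char_sqr -natr1 lerD ?lern1 ?leq_b1 //.
apply: (@le_trans _ _ (\sum_(v : F) 1)); last by rewrite sumr_const.
by apply: ler_sum => v _; rewrite -expr2 quad_char_sqr lern1 leq_b1.
Qed.

Lemma quad_char_bilinear_le (s t : F -> R) :
  (\sum_u \sum_v s u * t v * chi (f u v)) ^+ 2 <=
  #|F|.+1%:R * (\sum_u s u ^+ 2) * (\sum_v t v ^+ 2).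
Proof.
have -> : \sum_u \sum_v s u * t v * chi (f u v) =
    \sum_v (\sum_u s u * chi (f u v)) * t v.
  rewrite exchange_big; apply: eq_bigr => v _ /=.
  by rewrite mulr_suml; apply: eq_bigr => u _; ring.
apply: le_trans (sum_mul_sqr_le _ _) _.
apply: ler_wpM2r (quad_char_matrix_le s).
by apply: sumr_ge0 => ? _; exact: sqr_ge0.
Qed.

End BilinearSum.

(** * Edge counts and error terms after pulling back along [g] *)

Lemma sum_nat_of_bool (I : finType) (A P : pred I) :
  (\sum_(i in A) P i)%N = #|[set i in A | P i]|.
Proof. by rewrite cardsE -sum1_card [RHS]big_mkcondr. Qed.

Lemma le_mul_sqrt (R : rcfType) (m n x : R) : 0 <= m -> 0 <= n ->
  x ^+ 2 <= m ^+ 2 * n -> x <= m * Num.sqrt n.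
Proof.
move=> m0 n0 h; have [x0|/ltW x0] := leP 0 x; last first.
  by apply: le_trans x0 _; rewrite mulr_ge0 ?sqrtr_ge0.
by rewrite -ler_sqr ?nnegrE ?mulr_ge0 ?sqrtr_ge0 // exprMn sqr_sqrtr.
Qed.

Section PulledBackGraph.

Variables (R : rcfType) (F : finFieldType).
Hypothesis oddF : odd #|F|.
Variables a b c e : F.
Hypothesis det_neq0 : a * e - b * c != 0.
Variables (g k : F -> F) (d : nat).
Hypothesis d_gt0 : (0 < d)%N.
Hypothesis fiber_le : forall u, (#|[set x | g x == u]| <= d)%N.
Hypothesis zeros_le : (#|[set x | k x == 0%R]| <= d)%N.
Implicit Types S T : {set F}.

Local Notation chi := (quad_char R).
Local Notation f u v := ((a * u + c) * v + (b * u + e)).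
Local Notation w x y := (k x * k y * f (g x) (g y)).

(** Push-forward along [g] of the indicator of [S] signed by [chi (k x)]. *)
Let weight S u : R := \sum_(x in S | g x == u) chi (k x).

(** Each weight is at most the number [n] of points of [S] in its fiber, and [n <= d]; so its square
    is at most [d * n], and the [n] add up to [#|S|]. *)
Let sum_weight_sqr_le S : \sum_u weight S u ^+ 2 <= d%:R * #|S|%:R.
Proof.
have -> : #|S| = (\sum_u \sum_(x in S | g x == u) 1)%N.
  by rewrite -sum1_card (partition_big g predT).
rewrite natr_sum mulr_sumr.
apply: ler_sum => u _; set n := (\sum_(x in S | _) 1)%N.
have weight_le : `|weight S u| <= n%:R.
  apply: le_trans (ler_norm_sum _ _ _) _; rewrite natr_sum.
  by apply: ler_sum => x _; exact: quad_char_norm_le1.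
have n_le : (n <= d)%N.
  apply: leq_trans (fiber_le u); rewrite /n sum1_card.
  by apply/subset_leq_card/subsetP => x; rewrite !inE => /andP[_ ->].
rewrite -real_normK ?num_real // expr2.
by apply: ler_pM => //; apply: le_trans weight_le _; rewrite ler_nat.
Qed.

Let sum_quad_charE S T : \sum_(x in S) \sum_(y in T) chi (w x y) =
  \sum_u \sum_v weight S u * weight T v * chi (f u v).
Proof.
rewrite (partition_big g predT) //=; apply: eq_bigr => u _.
under eq_bigr do rewrite (partition_big g predT) //=.
rewrite exchange_big; apply: eq_bigr => v _ /=.
rewrite -mulrA /weight big_distrl /=.
apply: eq_bigr => x /andP[_ /eqP <-].
rewrite mulr_suml mulr_sumr; apply: eq_bigr => y /andP[_ /eqP <-].
by rewrite !quad_charM // mulrA.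
Qed.

Let norm_sum_quad_char_le S T :
  `|\sum_(x in S) \sum_(y in T) chi (w x y)| ^+ 2 <=
  (2 * d%:R) ^+ 2 * (#|F|%:R * (#|S|%:R * #|T|%:R)).
Proof.
rewrite real_normK ?num_real // sum_quad_charE.
apply: le_trans (quad_char_bilinear_le oddF det_neq0 _ _) _.
(* The factor 4 is a perfect square, so the bound has the clean constant [2 * d] after taking
   roots. *)
have q_le : #|F|.+1%:R <= 4 * #|F|%:R :> R.
  by rewrite -natrM ler_nat; move: (finNzRing_gt1 F); lia.
rewrite (_ : (2 * d%:R) ^+ 2 * _ =
  (4 * #|F|%:R) * (d%:R * #|S|%:R) * (d%:R * #|T|%:R)); last by ring.
have sqr_sum_ge0 U : 0 <= \sum_u weight U u ^+ 2.
  by apply: sumr_ge0 => u _; exact: sqr_ge0.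
by apply: ler_pM => //; [exact: mulr_ge0 | apply: ler_pM].
Qed.

(** A nonzero affine form has at most one root, so the zeros lie in a single fiber of [g]. *)
Let affine_zeros_le T u v : ~~ ((u == 0) && (v == 0)) ->
  \sum_(y in T) (u * g y + v == 0)%:R <= d%:R :> R.
Proof.
move=> uv; rewrite -natr_sum ler_nat sum_nat_of_bool.
have [u0|u0] := eqVneq u 0.
  rewrite eq_card0 // => y; rewrite !inE u0 mul0r add0r.
  by move: uv; rewrite u0 eqxx /= => /negbTE ->; rewrite andbF.
apply: leq_trans (fiber_le (- v / u)).
apply/subset_leq_card/subsetP => y; rewrite !inE => /andP[_].
by rewrite addr_eq0 => /eqP <-; rewrite mulrAC mulfV ?mul1r.
Qed.

Let bound S T : R := Num.sqrt (#|F|%:R * (#|S|%:R * #|T|%:R)).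

Let q_ge1 : 1 <= #|F|%:R :> R.
Proof. by rewrite ler1n; move: (finNzRing_gt1 F); lia. Qed.

Let d_ge1 : 1 <= d%:R :> R.
Proof. by rewrite ler1n. Qed.

(** Two upper bounds on [x] yield their geometric mean, which is how every error term reaches the
    form [bound]. *)
Let le_bound S T (m x y z : R) : 0 <= m -> 0 <= x ->
  x <= y -> x <= z -> y * z <= m ^+ 2 * (#|F|%:R * (#|S|%:R * #|T|%:R)) ->
  x <= m * bound S T.
Proof.
move=> m0 x0 xy xz yz; apply: le_mul_sqrt; rewrite ?mulr_ge0 //.
by apply: le_trans yz; rewrite expr2 ler_pM.
Qed.

Let le_bound_min S T (m x : R) : 0 <= m -> 0 <= x ->
  x <= m * #|S|%:R -> x <= m * #|T|%:R -> x <= m * bound S T.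
Proof.
move=> m0 x0 xS xT; apply: le_bound xS xT _ => //.
rewrite (_ : _ * _ = m ^+ 2 * (1 * (#|S|%:R * #|T|%:R))); last by ring.
by rewrite ler_wpM2l ?sqr_ge0 // ler_wpM2r // mulr_ge0.
Qed.

(** Fixing either variable leaves an affine form in the other, nonzero since the determinant is.
    This gives at most [d] zeros per row and per column. *)
Let kernel_zeros_le S T :
  \sum_(x in S) \sum_(y in T) (f (g x) (g y) == 0)%:R <= d%:R * bound S T.
Proof.
apply: le_bound_min => //.
- by do 2!apply: sumr_ge0 => ? _.
- rewrite mulr_natr -sumr_const; apply: ler_sum => x _.
  apply: affine_zeros_le; apply: contra det_neq0 => /andP[/eqP u0 /eqP v0].
  rewrite (_ : _ - _ = a * (b * g x + e) - b * (a * g x + c)); last by ring.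
  by rewrite u0 v0 !mulr0 subr0.
rewrite exchange_big mulr_natr -sumr_const; apply: ler_sum => y _ /=.
under eq_bigr => x _.
  rewrite (_ : _ + _ = (a * g y + b) * g x + (c * g y + e)); last by ring.
  over.
apply: affine_zeros_le; apply: contra det_neq0 => /andP[/eqP u0 /eqP v0].
rewrite (_ : _ - _ = a * (c * g y + e) - c * (a * g y + b)); last by ring.
by rewrite u0 v0 !mulr0 subr0.
Qed.

Let factor_zeros_le S T :
  \sum_(x in S) \sum_(y in T) (k x == 0)%:R <= d%:R * bound S T.
Proof.
under eq_bigr do rewrite sumr_const -(mulr_natr _ #|T|).
rewrite -mulr_suml -natr_sum sum_nat_of_bool; set n := #|_|.
have nS : n%:R <= #|S|%:R :> R.
  by rewrite ler_nat; apply/subset_leq_card/subsetP => x; rewrite inE => /andP[].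
have nd : n%:R <= d%:R :> R.
  rewrite ler_nat; apply: leq_trans zeros_le.
  by apply/subset_leq_card/subsetP => x; rewrite !inE => /andP[].
have Tq : #|T|%:R <= #|F|%:R :> R by rewrite ler_nat max_card.
(* The count is [n * #|T|]: use [n <= d] and [#|T| <= q] for one bound, [n <= #|S|] for the
   other. *)
apply: (@le_bound _ _ _ _ (d%:R * #|F|%:R) (#|S|%:R * #|T|%:R)) => //.
- by rewrite mulr_ge0.
- by rewrite ler_pM.
- by rewrite ler_pM.
rewrite [leRHS]mulrA ler_wpM2r ?mulr_ge0 // ler_wpM2r //.
by rewrite expr2 ler_peMl.
Qed.

Let diagonal_le S T :
  \sum_(x in S) \sum_(y in T) (x == y)%:R <= bound S T.
Proof.
have diag_le1 U (z : F) : \sum_(y in U) (z == y)%:R <= 1 :> R.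
  rewrite -natr_sum sum_nat_of_bool lern1 -[leqRHS](cards1 z).
  by apply/subset_leq_card/subsetP => y; rewrite !inE eq_sym => /andP[].
rewrite -[leRHS]mul1r; apply: le_bound_min => //.
- by do 2!apply: sumr_ge0 => ? _.
- by rewrite mul1r -sumr_const; apply: ler_sum => x _.
rewrite exchange_big mul1r -sumr_const; apply: ler_sum => y _ /=.
by under eq_bigr do rewrite eq_sym.
Qed.

Lemma pulled_back_edges_le S T :
  `|\sum_(x in S) \sum_(y in T) ((x != y) && is_squareb (w x y))%:R
    - #|S|%:R * #|T|%:R / 2| <=
  3 * d%:R * Num.sqrt #|F|%:R * Num.sqrt (#|S|%:R * #|T|%:R) :> R.
Proof.
rewrite -[leRHS]mulrA -sqrtrM // -/(bound S T).
set E := \sum_(x in S) _.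
pose M : R := \sum_(x in S) \sum_(y in T) chi (w x y).
pose Z : R := \sum_(x in S) \sum_(y in T) (w x y == 0)%:R.
pose D : R := \sum_(x in S) \sum_(y in T) ((x == y) && is_squareb (w x y))%:R.
(* Main term, character sum, zeros counted as squares, and diagonal pairs removed because the graph
   has no loops. *)
have EE : 2 * E = #|S|%:R * #|T|%:R + M + Z - 2 * D.
  rewrite (_ : #|S|%:R * _ = \sum_(x in S) \sum_(y in T) 1); last first.
    by rewrite !sumr_const -[RHS]mulr_natl.
  rewrite !mulr_sumr -!big_split -sumrB.
  apply: eq_bigr => x _; rewrite !mulr_sumr -!big_split -sumrB.
  apply: eq_bigr => y _ /=; rewrite -is_squareb_quad_char.
  by case: eqP => _; case: is_squareb => /=; ring.
have M_le : `|M| <= 2 * d%:R * bound S T.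
  apply: le_mul_sqrt; rewrite ?mulr_ge0 //; exact: norm_sum_quad_char_le.
have Z_ge0 : 0 <= Z by do 2!apply: sumr_ge0 => ? _.
have D_ge0 : 0 <= D by do 2!apply: sumr_ge0 => ? _.
(* A zero of the product comes from [k x], [k y] or [f], each costing at most [d * bound]. *)
have Z_le : Z <= 3 * d%:R * bound S T.
  have kS := factor_zeros_le S T; have kT := factor_zeros_le T S.
  rewrite /bound (mulrC #|T|%:R) -/(bound S T) exchange_big /= in kT.
  have := kernel_zeros_le S T.
  suff : Z <= \sum_(x in S) \sum_(y in T) (k x == 0)%:R +
      \sum_(x in S) \sum_(y in T) (k y == 0)%:R +
      \sum_(x in S) \sum_(y in T) (f (g x) (g y) == 0)%:R by lra.
  rewrite -!big_split; apply: ler_sum => x _; rewrite -!big_split.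
  apply: ler_sum => y _ /=; rewrite !mulf_eq0 -!natrD ler_nat.
  by do 3!case: eqP.
have D_le : D <= d%:R * bound S T.
  apply: (@le_trans _ _ (bound S T)); last by rewrite ler_peMl ?sqrtr_ge0.
  apply: le_trans (diagonal_le S T); do 2!apply: ler_sum => ? _.
  by rewrite ler_nat; case: eqP => //= _; case: is_squareb.
move: M_le; rewrite !ler_norml => /andP[M1 M2].
(* In units of [d * bound], [M + Z - 2 * D] lies between -4 and 5, so half of it is within 3. *)
by apply/andP; split; lra.
Qed.

End PulledBackGraph.

(** * Polynomials of bidegree (1, 1) and their determinant *)

Section BidegreeOneOne.

Variable F : finFieldType.
Implicit Types (f H : {poly {poly F}}) (A B p g : {poly F}).

Lemma bidegree11_coefE f : bidegree11 f ->
  f = (f`_1`_1 *: 'X + (f`_1`_0)%:P)%:P * 'X + (f`_0`_1 *: 'X + (f`_0`_0)%:P)%:P.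
Proof.
case=> sX sY.
have lin (p : {poly F}) : (size p <= 2)%N -> p = p`_1 *: 'X + (p`_0)%:P.
  move=> sp; apply/polyP => -[|[|i]]; rewrite coefD coefZ coefX coefC /=.
  - by rewrite mulr0 add0r.
  - by rewrite mulr1 addr0.
  by rewrite mulr0 addr0 nth_default // (leq_trans sp).
rewrite -!lin -?sY ?max_size_coefXY //.
apply/polyP => -[|[|i]]; rewrite coefD coefMX coefC /= ?coefC /= ?add0r ?addr0 //.
by rewrite nth_default // sX.
Qed.

(** Matches the coefficients [a], [b], [c], [e] of the bilinear bounds with [f]_1[_1], [f]_1[_0],
    [f]_0[_1], [f]_0[_0]. *)
Lemma bidegree11_hornerE f u v : bidegree11 f ->
  f.[u, v] = (f`_1`_1 * u + f`_0`_1) * v + (f`_1`_0 * u + f`_0`_0).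
Proof.
move=> /bidegree11_coefE {1}->.
rewrite !(hornerD, hornerM, hornerZ, hornerX, hornerC); ring.
Qed.

(** Factors of 1 are units, hence constants. As 1 is a square, no product A(x) B(y) is
    admissible. *)
Lemma primitive_kernel_split A B :
  primitive_kernel (A^:P * B%:P) (1 : {poly {poly F}}).
Proof.
have unit_size (p : {poly F}) : p \is a GRing.unit -> (size p <= 1)%N.
  by rewrite poly_unitE => /andP[/eqP ->].
split; last by exists A, B; rewrite mulr1.
- move=> p K pK; rewrite -(size_map_polyC p).
  have := size_mul_eq1 p^:P K.
  by rewrite -pK size_poly1 eqxx => /esym/andP[/eqP ->].
move=> p K pK; apply/unit_size/unitrP; exists K`_0.
have := congr1 (fun q : {poly {poly F}} => q`_0) pK.
by rewrite coefCM coef1 /= mulrC => <-.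
Qed.

(** Suppose the determinant vanishes. If [a != 0], then f = (a x + c)(y + b/a) splits. If [a = 0],
    then [b * c = 0], and f loses its dependence on x or on y. *)
Lemma admissible_det_neq0 f : bidegree11 f -> admissible f ->
  f`_1`_1 * f`_0`_0 - f`_1`_0 * f`_0`_1 != 0.
Proof.
move=> f11 [_ fH]; have [sX sY] := f11.
have fE := bidegree11_coefE f11.
move: {f11} (f`_1`_1) (f`_1`_0) (f`_0`_1) (f`_0`_0) fE => a b c e fE.
rewrite subr_eq0; apply/eqP => det0.
have [a0|a0] := eqVneq a 0; last first.
  apply: (fH 1); last by exists 1, 1; rewrite expr1n mulr1.
  suff -> : f = (a *: 'X + c%:P)^:P * ('X + (b / a)%:P)%:P.
    exact: primitive_kernel_split.
  have eE : e = b / a * c by rewrite mulrAC -det0 mulrAC mulfV ?mul1r.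
  have bE : b = a * (b / a) by rewrite mulrCA mulfV ?mulr1.
  rewrite fE eE {1}bE [(_ + _)^:P]rmorphD /= map_polyZ map_polyX map_polyC /=.
  by rewrite -!mul_polyC !(polyCD, polyCM); ring.
move: det0; rewrite a0 mul0r => /esym/eqP; rewrite mulf_eq0 => /orP[]/eqP z0.
  move: sX; rewrite fE a0 z0 scale0r addr0 polyC0 mul0r add0r => sX.
  by have := size_polyC_leq1 (c *: 'X + e%:P); rewrite sX.
suff : (sizeY f <= 1)%N by rewrite sY.
apply/bigmax_leqP => i _; move: (nat_of_ord i) => {}i.
rewrite fE a0 z0 !scale0r !add0r coefD coefMX !coefC.
case: i => [|[|i]] /=; rewrite ?coefC /= ?add0r ?addr0 ?size_poly0 //;
  exact: size_polyC_leq1.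
Qed.

Lemma card_roots_lt_size p : p != 0 -> (#|[set x | p.[x] == 0%R]| < size p)%N.
Proof.
move=> p0; rewrite cardE; apply: max_poly_roots; rewrite ?enum_uniq //.
by apply/allP => x; rewrite mem_enum inE.
Qed.

End BidegreeOneOne.

(** * The discrepancy bound for the family *)

Lemma natr_edges (R : pzRingType) (G : graph) (S T : {set G}) :
  (edges S T)%:R = \sum_(x in S) \sum_(y in T) (adj x y)%:R :> R.
Proof.
rewrite pair_big /= -natr_sum; congr (_%:R).
rewrite sum_nat_of_bool; apply: eq_card => -[x y].
by rewrite !inE /= andbA.
Qed.

Lemma family_H_edges_le (R : rcfType) (d : nat) (G : graph) (S T : {set G}) :
  (0 < d)%N -> family_H d G ->
  `|(edges S T)%:R - #|S|%:R * #|T|%:R / 2| <=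
  3 * d%:R * Num.sqrt #|G|%:R * Num.sqrt (#|S|%:R * #|T|%:R) :> R.
Proof.
move=> d_gt0 HG; rewrite natr_edges.
have fiber_le (F : finFieldType) (g : {poly F}) : size g = d.+1 ->
    forall u, (#|[set x | g.[x] == u]| <= d)%N.
  move=> sg u; have sgu : size (g - u%:P) = d.+1.
    rewrite size_polyDl // size_polyN sg ltnS.
    exact: leq_trans (size_polyC_leq1 u) _.
  have -> : [set x | g.[x] == u] = [set x | (g - u%:P).[x] == 0].
    by apply/setP => x; rewrite !inE hornerD hornerN hornerC subr_eq0.
  rewrite -ltnS -sgu.
  by apply: card_roots_lt_size; rewrite -size_poly_eq0 sgu.
case: HG S T => F f g oddF fadm f11 sg S T;
  have gfib := fiber_le F g sg; have fdet := admissible_det_neq0 f11 fadm.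
(* For [poly_h] take [k = 1]; for [poly_htilde] take [k = g], whose zeros form the fiber of [g] over
   0. *)
- have one_zeros : (#|[set x : F | (1%R : F) == 0%R]| <= d)%N.
    by rewrite eq_card0 // => x; rewrite !inE oner_eq0.
  have := pulled_back_edges_le R oddF fdet d_gt0 gfib one_zeros S T.
  under eq_bigr => x _. under eq_bigr => y _.
    rewrite !mul1r -bidegree11_hornerE // -poly_hE. over. over.
  by [].
have := pulled_back_edges_le R oddF fdet d_gt0 gfib (gfib 0) S T.
under eq_bigr => x _. under eq_bigr => y _.
  rewrite -bidegree11_hornerE // -poly_htildeE. over. over.
by [].
Qed.

(** * Unboundedness, witnessed by x + y over prime fields *)

Lemma bidegree11_XY (F : finFieldType) : bidegree11 ('X + 'Y : {poly {poly F}}).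
Proof.
have sX : size ('X + 'Y : {poly {poly F}}) = 2%N.
  by rewrite size_XaddC.
split=> //; rewrite sizeYE rmorphD /= swapXY_X swapXY_Y addrC.
by rewrite size_XaddC.
Qed.

(** If the kernel were a constant times [K ^+ 2], degree 1 in x would force [K] to be free of x, and
    x + y would split as a product of functions of x and of y. The 2 by 2 minor at the points 0 and
    1 rules this out. *)
Lemma admissible_XY (F : finFieldType) : admissible ('X + 'Y : {poly {poly F}}).
Proof.
have XYE (u v : F) : ('X + 'Y : {poly {poly F}}).[u, v] = u + v.
  by rewrite !hornerE.
split=> [u v|H [_ _ [A [B fE]]] [c [K HE]]]; first by rewrite !XYE addrC.
have [sX _] := bidegree11_XY F.
have XY0 : 'X + 'Y != 0 :> {poly {poly F}} by rewrite -size_poly_eq0 sX.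
set P := A^:P * B%:P * c%:P%:P.
have fPK : 'X + 'Y = P * K ^+ 2 by rewrite fE HE mulrA.
have /andP[P0 K0] : (P != 0) && (K != 0).
  by move: XY0; rewrite fPK mulf_eq0 expf_eq0 negb_or.
have sK : (size K <= 1)%N.
  have := size_exp K 2; have := sX; rewrite fPK size_mul ?expf_neq0 //.
  move: P0; rewrite -size_poly_gt0.
  by move: (size P) (size (K ^+ 2)) (size K) => m n r; lia.
have split_XY u v : u + v = A.[u] * (B * c%:P * (K`_0 * K`_0)).[v].
  rewrite -XYE fPK; move/size1_polyC: sK => {1}->; rewrite -polyC_exp expr2.
  rewrite !hornerM !hornerC horner_map /= hornerC hornerM; ring.
have : (0 + 1) * (1 + 0) = (0 + 0) * (1 + 1) :> F.
  by rewrite !split_XY; ring.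
by rewrite !(add0r, addr0, mul1r, mul0r) => /eqP; rewrite oner_eq0.
Qed.

Lemma family_H_unbounded (d : nat) : unbounded (family_H d).
Proof.
move=> N; have [p Np p_pr] := prime_above (maxn N 2).
have [Np' p2] : (N < p)%N /\ (2 < p)%N by move: Np; rewrite gtn_max => /andP.
exists (Xgraph (poly_h ('X + 'Y : {poly {poly 'F_p}}) 'X^d)); last first.
  by rewrite /= card_Fp.
apply: family_h; [|exact: admissible_XY|exact: bidegree11_XY|exact: size_polyXn].
by rewrite card_Fp //; case: (even_prime p_pr) p2 => [->|].
Qed.

Theorem theorem1p5 (R : realType) (d : nat) (hd : (1 <= d)%N) :
  QR (2^-1 : R) (family_H d).
Proof.
split; first exact: family_H_unbounded.
exists (3 * d%:R) => [|G HG S T]; first by rewrite mulr_gt0 ?ltr0n.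
by rewrite powR12_sqrt ?ler0n //; exact: family_H_edges_le.
Qed.
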